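(* Let $p,q,r\in(0,1)$ with $p+q+r=1$. Let $X_1,\eta_2,\eta_3,\ldots$ be independent random variables, each taking the values $1,-1,0$ with probabilities $p,q,r$ respectively, and let $K_3,K_4,\ldots$ be independent random variables, independent of the previous ones, with $K_{n+1}$ uniformly distributed on $\{1,n\}$. Set $X_2=\eta_2X_1$, $X_{n+1}=\eta_{n+1}X_{K_{n+1}}$ for $n\ge2$, and $S_n=\sum_{k=1}^nX_k$. Then, as $n\to\infty$, $S_n/n$ converges in distribution to a random variable $S$ taking the value $\frac{p-q}{2+q-p}$ with probability $p$, the value $0$ with probability $r$, and the value $-\frac{p-q}{2+q-p}$ with probability $q$. Moreover, for every real $\alpha>0$, $E|S_n/n|^\alpha\to E|S|^\alpha$, and for every positive integer $k$, $E\big((S_n/n)^k\big)\to E(S^k)$, as $n\to\infty$.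
   Context: This is the elephant random walk with delays in which the elephant remembers only the first step and the most recent step: step $n+1$ ($n\ge2$) picks one of $X_1,X_n$ uniformly at random and repeats it (probability $p$), reverses it (probability $q$), or is $0$ (probability $r$). Note that $|S_n/n|\le1$ for all $n$. *)

(* Defs.v *)
From HB Require Import structures.
From mathcomp Require Import all_boot all_order all_algebra.
From mathcomp Require Import all_classical all_reals all_analysis.
Set Implicit Arguments. Unset Strict Implicit. Unset Printing Implicit Defensive.
Import Order.TTheory GRing.Theory Num.Theory.
Import numFieldNormedType.Exports.
Local Open Scope classical_set_scope.
Local Open Scope ring_scope.

(* Index set of the driving random variables:
   None         = X_1,
   Some (inl n) = eta_n   (n >= 2),
   Some (inr n) = K_n     (n >= 3). *)
Definition idx := option (nat + nat).

Definition valid_idx (i : idx) : bool :=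
  match i with
  | None => true
  | Some (inl n) => (2 <= n)%N
  | Some (inr n) => (3 <= n)%N
  end.

Definition drive (T : Type) (R : realType) (X1 : T -> R) (eta : nat -> T -> R)
  (K : nat -> T -> nat) (i : idx) : T -> R :=
  match i with
  | None => X1
  | Some (inl n) => eta n
  | Some (inr n) => fun t => (K n t)%:R
  end.

Definition discrete_mutually_independent (d : measure_display)
  (T : measurableType d) (R : realType) (P : probability T R)
  (I : eqType) (valid : I -> bool) (F : I -> T -> R) : Prop :=
  forall (s : seq I), uniq s -> all valid s -> forall v : I -> R,
    P [set t | all (fun i => F i t == v i) s] =
    (\prod_(i <- s) P [set t | F i t = v i])%E.

(* The sequence [:: X_1; ...; X_n] of the elephant walk:
   X_2 = eta_2 X_1, X_{n+1} = eta_{n+1} X_{K_{n+1}} for n >= 2. *)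
Fixpoint elephant_steps (T : Type) (R : realType) (X1 : T -> R)
  (eta : nat -> T -> R) (K : nat -> T -> nat) (n : nat) (t : T) : seq R :=
  match n with
  | 0 => [::]
  | 1 => [:: X1 t]
  | m.+1 => let s := elephant_steps X1 eta K m t in
            let j := if m == 1%N then 0%N else (K m.+1 t).-1 in
            rcons s (eta m.+1 t * nth 0 s j)
  end.

Definition elephant_X (T : Type) (R : realType) (X1 : T -> R)
  (eta : nat -> T -> R) (K : nat -> T -> nat) (k : nat) (t : T) : R :=
  nth 0 (elephant_steps X1 eta K k t) k.-1.

Definition elephant_S (T : Type) (R : realType) (X1 : T -> R)
  (eta : nat -> T -> R) (K : nat -> T -> nat) (n : nat) (t : T) : R :=
  \sum_(1 <= k < n.+1) elephant_X X1 eta K k t.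

Definition limit_expect (R : realType) (p q r : R) (g : R -> R) : R :=
  let L := (p - q) / (2 + q - p) in
  p * g L + r * g 0 + q * g (- L).

(* Main.v *)
(* Write L = (p - q) / (2 + q - p).  Given the past, X_(n+1) has mean
   (p - q) (X_1 + X_n) / 2, so Y_n = X_n - L X_1 satisfies
   E(Y_(n+1) | past) = (p - q) / 2 * Y_n.  With T_n = Y_1 + ... + Y_n it follows
   that T_n^2 + 2 L Y_n T_n grows by at most 12 in conditional mean, whence
   E(S_n / n - L X_1)^2 = O(1 / n): S_n / n is close to L X_1 in mean square.
   All test functions are continuous and bounded on [-1, 1], where S_n / n
   lives, so their expectations converge by Chebyshev's argument.  Since finitely
   many discrete variables determine S_n, expectations are iterated finite sums
   over the values of these variables. *)
Require Import Defs.
From HB Require Import structures.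
From mathcomp Require Import all_boot all_order all_algebra.
From mathcomp Require Import ring lra.
From mathcomp Require Import all_classical all_reals all_analysis.
From mathcomp Require Import measurable_realfun.
Set Implicit Arguments. Unset Strict Implicit. Unset Printing Implicit Defensive.
Import Order.TTheory GRing.Theory Num.Theory.
Import numFieldNormedType.Exports.
Local Open Scope classical_set_scope.
Local Open Scope ring_scope.

(** * Expectations as iterated finite weighted sums *)

Definition upd (I : eqType) (R : Type) (v : I -> R) (i : I) (x : R) : I -> R :=
  fun j => if j == i then x else v j.

Lemma updE (I : eqType) (R : Type) (v : I -> R) (i : I) (x : R) (j : I) :
  upd v i x j = if j == i then x else v j.
Proof. by []. Qed.

(** Averages [phi] over the coordinates in [s], the head being the outermost sum; [v] supplies all
    other coordinates. Applied to later variables only, it acts as a conditional expectation given a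
    past recorded in [v]. *)
Fixpoint iexp (R : realType) (I : eqType) (D : I -> seq R) (w : I -> R -> R)
    (s : seq I) (phi : (I -> R) -> R) (v : I -> R) : R :=
  if s is i :: s' then \sum_(x <- D i) w i x * iexp D w s' phi (upd v i x)
  else phi v.

Section iterated_expectation.
Context {R : realType} {I : eqType}.
Variables (D : I -> seq R) (w : I -> R -> R).
Implicit Types (s : seq I) (phi psi : (I -> R) -> R) (v : I -> R).

Local Notation E := (iexp D w).

Definition admissible v := forall i, v i \in D i.

Lemma admissible_upd v i x : admissible v -> x \in D i -> admissible (upd v i x).
Proof. by move=> vD xD j; rewrite /upd; case: eqP => // ->. Qed.

(** The tower property: the inner average is conditional on the variables of [s1]. *)
Lemma iexp_cat s1 s2 phi v : E (s1 ++ s2) phi v = E s1 (E s2 phi) v.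
Proof. by elim: s1 v => //= i s1 IH v; apply: eq_bigr => x _; rewrite IH. Qed.

Lemma iexpZ s a phi v : E s (fun u => a * phi u) v = a * E s phi v.
Proof.
elim: s v => //= i s IH v; rewrite big_distrr/=.
by apply: eq_bigr => x _; rewrite IH mulrCA.
Qed.

Lemma iexpD s phi psi v : E s (fun u => phi u + psi u) v = E s phi v + E s psi v.
Proof.
elim: s v => //= i s IH v; rewrite -big_split/=.
by apply: eq_bigr => x _; rewrite IH mulrDr.
Qed.

Lemma iexpB s phi psi v : E s (fun u => phi u - psi u) v = E s phi v - E s psi v.
Proof.
rewrite iexpD -[- E s psi v]mulN1r -iexpZ; congr (_ + iexp _ _ _ _ _).
by apply/funext => u; rewrite mulN1r.
Qed.

Hypothesis w_ge0 : forall i x, x \in D i -> 0 <= w i x.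
Hypothesis w_sum1 : forall i, \sum_(x <- D i) w i x = 1.

Lemma iexp_le s phi psi v : admissible v ->
  (forall u, admissible u -> phi u <= psi u) -> E s phi v <= E s psi v.
Proof.
move=> + le; elim: s v => [v vD|i s IH v vD /=]; first exact: le.
rewrite big_seq [leRHS]big_seq; apply: ler_sum => x xD.
by apply: ler_wpM2l; [exact: w_ge0|exact/IH/admissible_upd].
Qed.

Lemma iexp_cst s a v : E s (fun=> a) v = a.
Proof.
elim: s v => //= i s IH v.
by under eq_bigr do rewrite IH; rewrite -mulr_suml w_sum1 mul1r.
Qed.

Lemma iexp_norm s phi v : admissible v -> `|E s phi v| <= E s (fun u => `|phi u|) v.
Proof.
move=> vD; rewrite ler_norml -mulN1r -iexpZ.
by rewrite !iexp_le// => u uD; rewrite ?mulN1r ?ler_norm// lerNl ler_normr lexx orbT.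
Qed.

Lemma iexp_past s phi v : (forall i u x, i \in s -> phi (upd u i x) = phi u) ->
  E s phi v = phi v.
Proof.
elim: s v => //= i s IH v h.
under eq_bigr => x _.
  rewrite IH; last by move=> j u y js; apply: h; rewrite inE js orbT.
  rewrite h ?inE ?eqxx//; over.
by rewrite -mulr_suml w_sum1 mul1r.
Qed.

(** * Integrals over the probability space as iterated sums *)

Context {d : measure_display} {T : measurableType d} (P : probability T R).
Variables (valid : I -> bool) (F : I -> T -> R).
Hypothesis mF : forall i, valid i -> measurable_fun setT (F i).
Hypothesis PF : forall i x, valid i -> x \in D i -> P [set t | F i t = x] = (w i x)%:E.
Hypothesis D_uniq : forall i, valid i -> uniq (D i).
Hypothesis F_indep : discrete_mutually_independent P valid F.

Local Notation cyl s v := [set t | all (fun i => F i t == v i) s].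

Lemma measurable_fiber i x : valid i -> measurable [set t | F i t = x].
Proof.
move=> vi; rewrite (_ : [set _ | _] = setT `&` F i @^-1` [set x]) ?setTI//.
by rewrite -[_ @^-1` _]setTI; apply: (mF vi) => //; exact: measurable_set1.
Qed.

Lemma measurable_cyl s v : all valid s -> measurable (cyl s v).
Proof.
elim: s => [_|i s IH /= /andP[vi vs]].
  by rewrite (_ : [set _ | _] = setT)//; exact/seteqP.
rewrite (_ : [set _ | _] = [set t | F i t = v i] `&` cyl s v).
  by apply: measurableI; [exact: measurable_fiber|exact: IH].
by apply/seteqP; split => t /= => [/andP[/eqP]|[/eqP -> ->]].
Qed.

Lemma prob_cyl s v : uniq s -> all valid s -> admissible v ->
  P (cyl s v) = (\prod_(i <- s) w i (v i))%:E.
Proof.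
move=> us vs vD; rewrite F_indep// -prodEFin big_seq [RHS]big_seq.
by apply: eq_bigr => i si; rewrite PF ?(allP vs).
Qed.

(* Only the values of [phi] on the cells [F = v], [v] admissible, matter; the
   rest of the space is negligible. *)
Lemma integral_cyl (G : T -> R) phi s0 s s' v :
  measurable_fun setT G ->
  (forall t u, admissible u -> all (fun i => F i t == u i) s0 -> G t = phi u) ->
  {subset s0 <= s ++ s'} -> uniq (s ++ s') -> all valid (s ++ s') ->
  admissible v ->
  (\int[P]_(t in cyl s' v) (G t)%:E)%E =
    ((\prod_(i <- s') w i (v i)) * E s phi v)%:E.
Proof.
(* The variables of [s'] are already fixed at [v], those of [s] remain to be summed out; each
   induction step moves one variable from [s] to [s']. Once [s] is empty, [G] is constant on the
   cylinder, whose mass is the product of the weights. *)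
move=> mG Gphi; elim: s s' v => [s' v s0s us vs vD|i s IH s' v s0s us vs vD].
  rewrite (eq_integral (cst (phi v)%:E)) => [|t /[!inE]/= tv]; last first.
    congr EFin; apply: Gphi => //; apply/allP => j /s0s.
    exact: (allP tv).
  rewrite integral_cst; last exact: measurable_cyl.
  by rewrite [X in (_ * X)%E](prob_cyl us vs vD) mulrC EFinM.
have perm : perm_eq (s ++ i :: s') ((i :: s) ++ s').
  by rewrite -cat_rcons perm_cat2r perm_rcons.
have us' : uniq (s ++ i :: s') by rewrite (perm_uniq perm).
have vs' : all valid (s ++ i :: s') by rewrite (perm_all _ perm).
have s0s' : {subset s0 <= s ++ i :: s'} by move=> j /s0s; rewrite (perm_mem perm).
have := us'; rewrite cat_uniq => /and3P[_ _ /= /andP[is' us1]].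
have := vs'; rewrite all_cat => /andP[_ /= /andP[vi vs1]].
have uDi := D_uniq vi.
(* The cylinder is cut along the values of [F i]. As [i] is not in [s'], each cell is again a
   cylinder, with [i] fixed as well. *)
pose C x := cyl s' v `&` [set t | F i t = x].
have CE x : C x = cyl (i :: s') (upd v i x).
  apply/seteqP; split => t /=.
    move=> [tv Fx]; rewrite updE eqxx Fx eqxx/=; apply/allP => j js'.
    rewrite updE; case: (eqVneq j i) => [ji|_]; last exact: (allP tv).
    by rewrite ji (negbTE is') in js'.
  rewrite updE eqxx => /andP[/eqP Fx /allP tv]; split => //; apply/allP => j js'.
  have := tv j js'; rewrite updE; case: (eqVneq j i) => [ji|//].
  by rewrite ji (negbTE is') in js'.
have mC x : measurable (C x) by rewrite CE; apply: measurable_cyl; rewrite /= vi.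
have prodC x : \prod_(j <- i :: s') w j (upd v i x j) =
    w i x * \prod_(j <- s') w j (v j).
  rewrite big_cons updE eqxx; congr (_ * _); apply: eq_big_seq => j js'.
  by rewrite updE; case: (eqVneq j i) => // ji; rewrite ji (negbTE is') in js'.
have tC : trivIset [set` D i] C.
  by move=> x y _ _ [t [[_ <-] [_ <-]]].
set U := \big[setU/set0]_(x <- D i) C x.
have mU : measurable U by exact: bigsetU_measurable.
have mA : measurable (cyl s' v) by exact: measurable_cyl.
have UA : U `<=` cyl s' v.
  by rewrite /U; elim/big_rec: _ => // x B _ IHB t [[]//|/IHB].
(* The weights of [i] sum to one, so the cells exhaust the mass of the cylinder and what is left
   over is a null set. *)
have PU : P U = P (cyl s' v).
  rewrite /U -bigcup_seq measure_fin_bigcup// -fsbig_seq// prob_cyl//.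
  transitivity (\sum_(x <- D i) (w i x * \prod_(j <- s') w j (v j))%:E)%E.
    apply: eq_big_seq => x xD; rewrite -prodC CE.
    by apply: prob_cyl; rewrite /= ?is' ?vi//; exact: admissible_upd.
  by rewrite sumEFin -mulr_suml w_sum1 mul1r.
have PAU : P (cyl s' v `\` U) = 0%E.
  rewrite measureD//; first rewrite setIidr// [X in (_ - X)%E]PU.
    exact: subee (fin_num_measure _ _ mA).
  by rewrite ltey_eq fin_num_measure.
rewrite -(setDUK UA) integral_setU//; first last.
- by apply/disj_set2P; rewrite setDE setICA setICr setI0.
- exact/measurable_EFinP/measurable_funTS.
- exact: measurableD.
rewrite [X in (_ + X)%E]null_set_integral//; first last.
- by apply/measurable_EFinP; exact: measurable_funTS.
- exact: measurableD.
rewrite adde0 integral_bigsetU_EFin//; last first.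
  by apply/measurable_EFinP; exact: measurable_funTS.
rewrite /= big_distrr/= -sumEFin; apply: eq_big_seq => x xD.
rewrite CE IH//; last exact: admissible_upd.
by rewrite prodC mulrCA mulrA.
Qed.

Lemma integral_iexp (G : T -> R) phi s v :
  measurable_fun setT G ->
  (forall t u, admissible u -> all (fun i => F i t == u i) s -> G t = phi u) ->
  uniq s -> all valid s -> admissible v ->
  (\int[P]_t (G t)%:E)%E = (E s phi v)%:E.
Proof.
move=> mG Gphi us vs vD.
have := @integral_cyl G phi s s [::] v mG Gphi; rewrite cats0 big_nil mul1r.
by rewrite (_ : [set _ | _] = setT); [apply|exact/seteqP].
Qed.

End iterated_expectation.

(** * The walk as a function of its driving values *)

Definition driving_values (R : realType) (i : idx) : seq R :=
  if i is Some (inr n) then [:: 1; n.-1%:R] else [:: 1; -1; 0].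

Definition driving_weight (R : realType) (p q r : R) (i : idx) (x : R) : R :=
  if i is Some (inr _) then 1 / 2
  else if x == 1 then p else if x == -1 then q else r.

(* Indices are shifted by two: [walk_step v m] is X_(m+2), [walk_sum v m] is
   S_(m+2), and [history m] lists the variables they depend on. *)
Fixpoint walk_step (R : realType) (v : idx -> R) (m : nat) : R :=
  if m is m'.+1 then v (Some (inl m'.+3)) *
    (if v (Some (inr m'.+3)) == 1 then v None else walk_step v m')
  else v (Some (inl 2%N)) * v None.

Definition walk_sum (R : realType) (v : idx -> R) (m : nat) : R :=
  v None + \sum_(k < m.+1) walk_step v k.

Fixpoint history (m : nat) : seq idx :=
  if m is m'.+1 then history m' ++ [:: Some (inl m'.+3); Some (inr m'.+3)]
  else [:: None; Some (inl 2%N)].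

(** The step at which a variable first acts on the walk. It separates new variables from the
    history, which gives both the absence of repetitions and the independence of the past from later
    updates. *)
Definition idx_time (i : idx) : nat :=
  match i with None => 1 | Some (inl n) => n | Some (inr n) => n end.

Lemma history_time m : all (fun i => idx_time i <= m.+2)%N (history m).
Proof.
elim: m => //= m IH; rewrite all_cat /= !leqnn !andbT.
by apply: sub_all IH => i /leq_trans; apply.
Qed.

Lemma history_uniq m : uniq (history m).
Proof.
elim: m => //= m IH; rewrite cat_uniq IH/= orbF andbT.
by apply/norP; split; apply/negP => /(allP (history_time m)); rewrite /= ltnn.
Qed.

Lemma history_valid m : all valid_idx (history m).
Proof. by elim: m => //= m IH; rewrite all_cat IH. Qed.

Section walk.
Context {R : realType}.
Implicit Types (v : idx -> R) (m : nat).

Lemma walk_step_upd v i x m : (m.+2 < idx_time i)%N ->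
  walk_step (upd v i x) m = walk_step v m.
Proof.
have neq j : (idx_time j < idx_time i)%N -> upd v i x j = v j.
  by move=> ji; rewrite updE; case: eqP => // ij; rewrite ij ltnn in ji.
elim: m => [|m IH] mi /=; first by rewrite !neq//= (leq_ltn_trans _ mi).
by rewrite !neq//= ?IH// (leq_ltn_trans _ mi).
Qed.

Lemma walk_sum_upd v i x m : (m.+2 < idx_time i)%N ->
  walk_sum (upd v i x) m = walk_sum v m.
Proof.
move=> mi; congr (_ + _).
  by rewrite updE; case: eqP => // ij; rewrite -ij in mi.
apply: eq_bigr => k _; apply: walk_step_upd; apply: leq_ltn_trans mi.
by rewrite !ltnS -ltnS.
Qed.

Lemma walk_sumS v m : walk_sum v m.+1 = walk_sum v m + walk_step v m.+1.
Proof. by rewrite /walk_sum big_ord_recr/= addrA. Qed.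

Local Notation admissible := (admissible (@driving_values R)).

Lemma admissible_norm v i : admissible v ->
  (if i is Some (inr _) then false else true) -> `|v i| <= 1.
Proof.
move=> /(_ i); case: i => [[n|n]|]//=; rewrite !inE.
all: by move=> /or3P[]/eqP-> _; rewrite ?normr1 ?normrN1 ?normr0.
Qed.

Lemma walk_step_le1 v m : admissible v -> `|walk_step v m| <= 1.
Proof.
move=> vD; elim: m => [|m IH]/=; rewrite normrM mulr_ile1// ?admissible_norm//.
by case: ifP => // _; exact: admissible_norm.
Qed.

Lemma walk_sum_le v m : admissible v -> `|walk_sum v m| <= m.+2%:R.
Proof.
move=> vD; rewrite (le_trans (ler_normD _ _))// -[m.+2]add1n natrD lerD//.
  exact: admissible_norm.
rewrite (le_trans (ler_norm_sum _ _ _))//.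
have -> : m.+1%:R = \sum_(k < m.+1) 1 :> R by rewrite sumr_const card_ord.
by apply: ler_sum => k _; exact: walk_step_le1.
Qed.

End walk.

(** * Conditional drift, the second moment bound and the resulting convergence *)

Section drift.
Context {R : realType} {p q r : R}.
Hypotheses (p_gt0 : 0 < p) (q_gt0 : 0 < q) (r_gt0 : 0 < r).
Hypothesis pqr : p + q + r = 1.

Local Notation E := (iexp (@driving_values R) (driving_weight p q r)).
Local Notation admissible := (admissible (@driving_values R)).

Lemma N1_neq1 : (-1 == 1 :> R) = false.
Proof. by apply/negbTE; rewrite lt_eqF//; lra. Qed.

Lemma zero_neqN1 : (0 == -1 :> R) = false.
Proof. by apply/negbTE; rewrite gt_eqF//; lra. Qed.

Lemma driving_weight_ge0 i x : 0 <= driving_weight p q r i x.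
Proof.
have [p0 q0 r0 pqr1] := And4 p_gt0 q_gt0 r_gt0 pqr.
rewrite /driving_weight; case: i => [[n|n]|]; [|lra|].
all: by case: (x == 1); case: (x == -1) => /=; lra.
Qed.

Lemma driving_weight_sum1 i :
  \sum_(x <- driving_values R i) driving_weight p q r i x = 1.
Proof.
have [p0 q0 r0 pqr1] := And4 p_gt0 q_gt0 r_gt0 pqr.
case: i => [[n|n]|]; rewrite /driving_weight !big_cons big_nil;
  rewrite ?eqxx ?N1_neq1 ?[0 == 1]eq_sym ?oner_eq0 ?zero_neqN1.
all: lra.
Qed.

(** All variables other than [X_1] sum out with total weight one, leaving the three-point law of
    [X_1]. *)
Lemma iexp_history0 (g : R -> R) m v :
  E (history m) (fun u => g (u None)) v = p * g 1 + q * g (-1) + r * g 0.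
Proof.
have E1 : E [:: None] (fun u => g (u None)) v = p * g 1 + q * g (-1) + r * g 0.
  rewrite /= !big_cons big_nil /driving_weight eqxx N1_neq1.
  rewrite [0 == 1]eq_sym oner_eq0 zero_neqN1 !updE eqxx.
  by rewrite eqxx addr0 !addrA.
elim: m => [|m IH].
  rewrite -E1 -[history 0]/([:: None] ++ [:: Some (inl 2%N)]) iexp_cat.
  congr iexp; apply/funext => u; rewrite iexp_past//; first exact: driving_weight_sum1.
  by move=> i u' x; rewrite inE => /eqP ->.
rewrite -IH iexp_cat; congr iexp; apply/funext => u; rewrite iexp_past//.
  exact: driving_weight_sum1.
by move=> i u' x; rewrite !inE => /orP[]/eqP ->.
Qed.

(** The transition from time [m + 2] to [m + 3]: the new variables leave the earlier walk unchanged,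
    and a fair choice between [X_1] and the latest step is repeated, reversed or replaced by
    zero. *)
Lemma iexp_step (h : R -> R -> R -> R -> R) m v :
  E [:: Some (inl m.+3); Some (inr m.+3)]
    (fun u => h (u None) (walk_step u m) (walk_sum u m) (walk_step u m.+1)) v =
  let g := h (v None) (walk_step v m) (walk_sum v m) in
  1 / 2 * (p * g (v None) + q * g (- v None) + r * g 0) +
  1 / 2 * (p * g (walk_step v m) + q * g (- walk_step v m) + r * g 0).
Proof.
rewrite /= !big_cons !big_nil /driving_weight eqxx N1_neq1.
rewrite [0 == 1]eq_sym oner_eq0 zero_neqN1.
rewrite !eqxx !walk_step_upd ?walk_sum_upd//= !updE /= !eqxx.
(* The other value of [K], namely [m + 2], differs from 1 and so selects the latest step. *)
rewrite (_ : _ == _ = false); last by apply/negbTE; rewrite pnatr_eq1.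
by rewrite !mul1r !mul0r !mulN1r; field.
Qed.

Let L := (p - q) / (2 + q - p).

Lemma drift_norm : `|L| <= 1.
Proof.
have [p0 q0 r0 pqr1] := And4 p_gt0 q_gt0 r_gt0 pqr.
rewrite normrM normfV [X in _ / X]gtr0_norm ?ler_pdivrMr; try lra.
by rewrite ler_norml; lra.
Qed.

(* The cross term [2 L Y T] absorbs the correlation between successive steps,
   so that the conditional mean of the potential grows by at most a constant. *)
Definition potential (u : idx -> R) m : R :=
  let T := walk_sum u m - m.+2%:R * (L * u None) in
  let Y := walk_step u m - L * u None in
  T ^+ 2 + 2 * L * Y * T.

(** With [T' = T + Y'], the new potential expands to [T^2 + 2 (1 + L) Y' T + (1 + 2 L) Y'^2]. The
    mean of [Y'] is [(p - q) / 2] times [Y], and [(1 + L) (p - q) / 2 = L], so the first two terms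
    average exactly to the old potential. Only the bounded square term remains. *)
Lemma iexp_potential m v : admissible v ->
  E [:: Some (inl m.+3); Some (inr m.+3)] (fun u => potential u m.+1) v <=
  potential v m + 12.
Proof.
have [p0 q0 r0 pqr1] := And4 p_gt0 q_gt0 r_gt0 pqr.
move=> vD.
pose h (x1 x s y : R) : R :=
  let T := s + y - m.+3%:R * (L * x1) in
  let Y := y - L * x1 in
  T ^+ 2 + 2 * L * Y * T.
rewrite (_ : (fun u => _) = fun u : idx -> R =>
    h (u None) (walk_step u m) (walk_sum u m) (walk_step u m.+1)); last first.
  by apply/funext => u; rewrite /potential walk_sumS.
rewrite iexp_step /= /potential.
have := @walk_step_le1 _ v m vD; have := @admissible_norm _ v None vD isT.
move: (v None) (walk_step v m) (walk_sum v m) => x1 x s x1le xle.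
pose d y : R := (y - L * x1) ^+ 2.
have d_le y : `|y| <= 1 -> d y <= 4.
  move=> yle; have : `|y - L * x1| <= 2.
    rewrite (le_trans (ler_normB _ _))// -[2]/(1 + 1) lerD//.
    by rewrite normrM mulr_ile1// drift_norm.
  by rewrite ler_norml /d; nra.
have -> : 1 / 2 * (p * h x1 x s x1 + q * h x1 x s (- x1) + r * h x1 x s 0) +
  1 / 2 * (p * h x1 x s x + q * h x1 x s (- x) + r * h x1 x s 0) =
  (s - m.+2%:R * (L * x1)) ^+ 2 + 2 * L * (x - L * x1) * (s - m.+2%:R * (L * x1)) +
  (1 + 2 * L) * (1 / 2 * (p * d x1 + q * d (- x1) + r * d 0) +
  1 / 2 * (p * d x + q * d (- x) + r * d 0)).
  rewrite /h /d -[m.+3]addn1 natrD; move: m.+2%:R => M.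
  have -> : r = 1 - p - q by lra.
  rewrite /L; field; lra.
rewrite lerD2l.
have d1 := d_le _ x1le; have d2 := d_le _ xle.
have d0 : d 0 <= 4 by rewrite d_le// normr0.
have d3 : d (- x1) <= 4 by rewrite d_le// normrN.
have d4 : d (- x) <= 4 by rewrite d_le// normrN.
(* [V] is the conditional mean of [Y'^2], where [Y'] is at most 2 in absolute value. Thus [V] lies
   in [[0, 4]] while [1 + 2 L] is at most 3, whence the constant 12. *)
set V := (X in _ * X).
have V4 : V <= 4.
  rewrite /V.
  have -> : 4 = 1 / 2 * (p * 4 + q * 4 + r * 4) +
              1 / 2 * (p * 4 + q * 4 + r * 4) by nra.
  by rewrite lerD// ler_pM2l//; try lra; rewrite !lerD// ler_pM2l.
have V0 : 0 <= V.
  rewrite /V; have dp y : 0 <= d y by exact: sqr_ge0.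
  by rewrite !addr_ge0// mulr_ge0//; try lra; rewrite !addr_ge0// mulr_ge0// ltW.
by have := drift_norm; rewrite ler_norml => /andP[]; nra.
Qed.

(** Initially [T] is at most 4 and [Y] at most 2 in absolute value, so the potential is at most
    [16 + 2 * 2 * 4 = 32]; the tower property then adds 12 per step. *)
Lemma iexp_potential_history m v : admissible v ->
  E (history m) (potential ^~ m) v <= 32 + 12 * m%:R.
Proof.
move=> vD; elim: m => [|m IH].
  rewrite -[leRHS](iexp_cst driving_weight_sum1 (history 0) _ v).
  apply: iexp_le => // [i x _|u uD]; first exact: driving_weight_ge0.
  rewrite /potential /walk_sum big_ord1.
  have := @walk_step_le1 _ u 0 uD; have := @admissible_norm _ u None uD isT.
  move: (u None) (walk_step u 0) => x1 x x1le xle.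
  have Lx1 : `|L * x1| <= 1 by rewrite normrM mulr_ile1// drift_norm.
  have := drift_norm; move: Lx1; move: L (L * x1) => l z zle lle.
  have Yle : `|x - z| <= 2.
    by rewrite (le_trans (ler_normB _ _))// -[2]/(1 + 1) lerD.
  have Tle : `|x1 + x - 2 * z| <= 4.
    rewrite (le_trans (ler_normB _ _))// (_ : 4 = 1 + 1 + 2 * 1) ?lerD//; last lra.
      by rewrite (le_trans (ler_normD _ _))// lerD.
    by rewrite normrM normr_nat ler_pM2l.
  move: (x - z) (x1 + x - 2 * z) Yle Tle => Y T Yle Tle.
  rewrite mulr0 addr0 (le_trans (ler_norm _))// (le_trans (ler_normD _ _))//.
  rewrite normrX !normrM normr_nat.
  have lY : `|l| * `|Y| <= 1 * 2 by rewrite ler_pM.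
  have lYT : `|l| * `|Y| * `|T| <= 1 * 2 * 4 by rewrite ler_pM// mulr_ge0.
  have T2 : `|T| ^+ 2 <= 4 ^+ 2 by rewrite lerXn2r// nnegrE.
  by rewrite -!mulrA in lYT *; lra.
rewrite /= iexp_cat.
apply: (@le_trans _ _ (E (history m) (fun u => potential u m + 12) v)).
  apply: iexp_le => // [i x _|u uD]; first exact: driving_weight_ge0.
  exact: iexp_potential.
rewrite iexpD iexp_cst; last exact: driving_weight_sum1.
by rewrite -[m.+1]addn1 natrD; lra.
Qed.

(** With [c = L Y], bounded by 2 in absolute value, [2 (T^2 + 2 c T + 8) - T^2 = (T + 2 c)^2 + 16 -
    4 c^2] is nonnegative. Hence [T^2] is at most twice the potential plus 16, and dividing by the
    squared time gives the rate. *)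
Lemma iexp_deviation m v : admissible v ->
  E (history m) (fun u => (walk_sum u m / m.+2%:R - L * u None) ^+ 2) v <=
  40 / m.+2%:R.
Proof.
move=> vD; have mgt0 : 0 < m.+2%:R :> R by rewrite ltr0n.
apply: (@le_trans _ _ (E (history m)
    (fun u => 2 / m.+2%:R ^+ 2 * (potential u m + 8)) v)).
  apply: iexp_le => // [i x _|u uD]; first exact: driving_weight_ge0.
  rewrite /potential.
  have := @walk_step_le1 _ u m uD; have := @admissible_norm _ u None uD isT.
  move: (u None) (walk_step u m) (walk_sum u m) => x1 x s x1le xle.
  have Lx1 : `|L * x1| <= 1 by rewrite normrM mulr_ile1// drift_norm.
  have := drift_norm; move: Lx1; move: L (L * x1) => l z zle lle.
  have Yle : `|x - z| <= 2.
    by rewrite (le_trans (ler_normB _ _))// -[2]/(1 + 1) lerD.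
  have lY : `|l * (x - z)| <= 1 * 2 by rewrite normrM ler_pM.
  set T := s - _.
  have -> : s / m.+2%:R - z = T / m.+2%:R by rewrite /T; field; lra.
  rewrite expr_div_n ler_pdivrMr ?exprn_gt0// mulrAC divfK ?gt_eqF ?exprn_gt0//.
  rewrite -(mulrA 2 l); move: (l * (x - z)) T lY => c T; rewrite ler_norml => /andP[? ?].
  have c4 : c ^+ 2 <= 4 by nra.
  by have := sqr_ge0 (T + 2 * c); nra.
rewrite iexpZ iexpD iexp_cst; last exact: driving_weight_sum1.
(* The potential bound gives [2 (32 + 12 m + 8) = 80 + 24 m], which is at most [40 (m + 2)]. *)
have le40 : 2 * (E (history m) (potential ^~ m) v + 8) <= 40 * m.+2%:R.
  by have := iexp_potential_history m vD; have := ler0n R m;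
    rewrite -[m.+2]addn2 natrD; lra.
by rewrite mulrAC expr2 invfM mulrA ler_pM2r ?invr_gt0// ler_pdivrMr//.
Qed.

Lemma cvg_walk (f : R -> R) (B : R) v : continuous f ->
  (forall x, `|x| <= 1 -> `|f x| <= B) -> admissible v ->
  E (history m) (fun u => f (walk_sum u m / m.+2%:R)) v @[m --> \oo] -->
  limit_expect p q r f.
Proof.
move=> cf fB vD.
have B_ge0 : 0 <= B by rewrite (le_trans (normr_ge0 _) (fB 0 _))// normr0.
apply/cvgrPdist_le => e e_gt0.
(* The limit [L X_1] takes only the values [L], [-L] and 0, so continuity at these three points
   yields a common radius. *)
have [dl dl_gt0 near_f] : exists2 dl : R, 0 < dl &
    forall x y, x \in driving_values R None -> `|L * x - y| < dl ->
    `|f (L * x) - f y| <= e / 2.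
  have near1 x : exists2 dl : R, 0 < dl &
      forall y, `|L * x - y| < dl -> `|f (L * x) - f y| <= e / 2.
    have /cvgrPdist_le /(_ (e / 2)) := cf (L * x).
    by case=> [|dl /= ? H]; [lra|exists dl => // y; exact: H].
  have [d1 d1_gt0 H1] := near1 1; have [d2 d2_gt0 H2] := near1 (-1).
  have [d3 d3_gt0 H3] := near1 0.
  exists (Num.min d1 (Num.min d2 d3)); first by rewrite !lt_min d1_gt0 d2_gt0.
  move=> x y; rewrite !inE !lt_min => /or3P[]/eqP-> /and3P[? ? ?].
  - exact: H1.
  - exact: H2.
  - exact: H3.
have -> : limit_expect p q r f = E (history 0) (fun u => f (L * u None)) v.
  rewrite (iexp_history0 (fun x => f (L * x))) /limit_expect -/L.
  by rewrite mulr0 mulr1 mulrN1 addrAC.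
(* Chebyshev's constant: at distance at least [dl], the difference of the two values of [f] is at
   most [2 B], hence at most [C] times the squared distance. *)
pose C := 2 * B / dl ^+ 2.
have C_ge0 : 0 <= C by rewrite divr_ge0 ?sqr_ge0 ?mulr_ge0.
near=> m.
(* Both terms are put on the same history, so that they can be compared pointwise. *)
have -> : E (history 0) (fun u => f (L * u None)) v =
          E (history m) (fun u => f (L * u None)) v.
  by rewrite !(iexp_history0 (fun x => f (L * x))).
have m_gt0 : 0 < m.+2%:R :> R by rewrite ltr0n.
rewrite -iexpB.
rewrite (le_trans (iexp_norm _ _ _ _))//; first by move=> *; exact: driving_weight_ge0.
apply: (@le_trans _ _ (E (history m) (fun u =>
    e / 2 + C * (walk_sum u m / m.+2%:R - L * u None) ^+ 2) v)).
  apply: iexp_le => // [i x _|u uD]; first exact: driving_weight_ge0.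
  have yle : `|walk_sum u m / m.+2%:R| <= 1.
    rewrite normrM normfV [X in _ / X]gtr0_norm// ler_pdivrMr// mul1r.
    exact: walk_sum_le.
  have zle : `|L * u None| <= 1.
    by rewrite normrM mulr_ile1// ?drift_norm// admissible_norm.
  move: (walk_sum u m / m.+2%:R) yle => y yle.
  have [near_y|far_y] := ltP `|L * u None - y| dl.
    rewrite (le_trans (near_f _ _ (uD None) near_y))// lerDl mulr_ge0//.
    exact: sqr_ge0.
  rewrite (le_trans (ler_normB _ _))// (@le_trans _ _ (2 * B))//.
    by have := fB _ yle; have := fB _ zle; lra.
  rewrite ler_wpDl//; first by rewrite divr_ge0// ltW.
  rewrite /C -mulrA ler_peMr ?mulr_ge0// mulrC ler_pdivlMr ?exprn_gt0// mul1r.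
  by rewrite -[leRHS]real_normK ?num_real// distrC lerXn2r// nnegrE ltW.
rewrite iexpD iexp_cst ?iexpZ; last exact: driving_weight_sum1.
have : C * E (history m) (fun u => (walk_sum u m / m.+2%:R - L * u None) ^+ 2) v
    <= C * (40 / m.+2%:R) by rewrite ler_wpM2l// iexp_deviation.
have : C * (40 / m.+2%:R) <= e / 2.
  rewrite mulrA ler_pdivrMr// -ler_pdivrMl ?divr_gt0//.
  have : (e / 2)^-1 * (C * 40) <= m%:R by near: m; exact: nbhs_infty_ger.
  by move=> /le_trans; apply; rewrite ler_nat -addn2 leq_addr.
move=> Cle Ele; apply: le_trans (lerD (lexx (e / 2)) (le_trans Ele Cle)) _; lra.
Unshelve. all: by end_near. Qed.

End drift.

(** Away from 0 the power is differentiable at the positive number [|x|]; at 0 the radius is the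
    [a]-th root of [e]. *)
Lemma continuous_norm_powR (R : realType) (a : R) : 0 < a ->
  continuous (fun x : R => `|x| `^ a).
Proof.
move=> a_gt0 x; have [->|x_neq0] := eqVneq x 0.
  apply/cvgrPdist_le => e e_gt0; exists (e `^ a^-1); first exact: powR_gt0.
  move=> y /=; rewrite sub0r normrN => y_lt.
  rewrite normr0 powR0 ?gt_eqF// sub0r normrN ger0_norm ?powR_ge0//.
  have -> : e = (e `^ a^-1) `^ a by rewrite -powRrM mulVf ?gt_eqF// powRr1// ltW.
  by apply: ge0_ler_powR; rewrite ?nnegrE ?powR_ge0// ltW.
have cpow : {for `|x|, continuous (fun y : R => y `^ a)}.
  apply/differentiable_continuous/derivable1_diffP/derivable_powR.
  by rewrite in_itv/= andbT normr_gt0.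
exact: (continuous_comp (@norm_continuous _ R x) cpow).
Qed.

(** * Identification of the recursively built list of steps with the walk *)

Section elephant.
Context {T : Type} {R : realType}.
Variables (X1 : T -> R) (eta : nat -> T -> R) (K : nat -> T -> nat).

Local Notation steps := (elephant_steps X1 eta K).

Lemma elephant_stepsS n t : (0 < n)%N ->
  steps n.+1 t = rcons (steps n t) (eta n.+1 t *
    nth 0 (steps n t) (if n == 1%N then 0%N else (K n.+1 t).-1)).
Proof. by case: n. Qed.

Lemma size_elephant_steps n t : size (steps n t) = n.
Proof. by elim: n => // -[//|n] IH; rewrite elephant_stepsS// size_rcons IH. Qed.

Lemma nth0_elephant_steps n t : nth 0 (steps n.+1 t) 0 = X1 t.
Proof.
by elim: n => // n IH; rewrite elephant_stepsS// nth_rcons size_elephant_steps.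
Qed.

Lemma elephant_XS n t : (0 < n)%N -> elephant_X X1 eta K n.+1 t =
  eta n.+1 t * nth 0 (steps n t) (if n == 1%N then 0%N else (K n.+1 t).-1).
Proof.
move=> n_gt0; rewrite /elephant_X elephant_stepsS// nth_rcons size_elephant_steps.
by rewrite ltnn eqxx.
Qed.

Lemma elephant_X_walk t (v : idx -> R) m :
  admissible (@driving_values R) v ->
  all (fun i => drive X1 eta K i t == v i) (history m) ->
  elephant_X X1 eta K m.+2 t = walk_step v m.
Proof.
move=> vD; elim: m => [|m IH].
  by rewrite elephant_XS//= => /and3P[/eqP<- /eqP<- _].
rewrite elephant_XS// [history m.+1]/= all_cat => /andP[tv].
rewrite [walk_step _ _.+1]/= => /and3P[/eqP <- /eqP Kv _].
congr (_ * _).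
have vN : v None = X1 t.
  apply/esym/eqP/(allP tv None); by elim: (m) => // k; rewrite mem_cat => ->.
(* Admissibility leaves two values for [K]: 1 points at the head [X_1] of the list, and [m + 2],
   lowered by one, at its last entry. *)
have := vD (Some (inr m.+3)); rewrite -Kv !inE eqr_nat pnatr_eq1 => /orP[]/eqP ->.
  by rewrite eqxx vN -(nth0_elephant_steps m.+1 t).
by rewrite -IH.
Qed.

Lemma elephant_S_walk t (v : idx -> R) m :
  admissible (@driving_values R) v ->
  all (fun i => drive X1 eta K i t == v i) (history m) ->
  elephant_S X1 eta K m.+2 t = walk_sum v m.
Proof.
move=> vD; rewrite /elephant_S; elim: m => [|m IH] tv.
  rewrite unlock /= /walk_sum big_ord1 addr0 (elephant_X_walk vD tv).
  by move: tv => /= /andP[/eqP <- _].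
rewrite big_nat_recr//= (elephant_X_walk vD tv) walk_sumS IH//.
by move: tv; rewrite /= all_cat => /andP[].
Qed.

End elephant.

(** * Measurability of the walk *)

Section measurability.
Context {d : measure_display} {T : measurableType d} {R : realType}.
Variables (X1 : T -> R) (eta : nat -> T -> R) (K : nat -> T -> nat).
Hypothesis mX1 : measurable_fun setT X1.
Hypothesis meta : forall n, (2 <= n)%N -> measurable_fun setT (eta n).
Hypothesis mK : forall n, (3 <= n)%N -> measurable_fun setT (fun t => (K n t)%:R : R).

Lemma measurable_nth_steps n j :
  measurable_fun setT (fun t => nth 0 (elephant_steps X1 eta K n t) j).
Proof.
elim: n j => [|[|n] IH] j.
- by rewrite (_ : (fun _ => _) = cst 0)//; apply/funext => t /=; rewrite nth_nil.
- by case: j => [|j]//=; rewrite (_ : (fun _ => _) = cst 0)//;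
    apply/funext => t /=; rewrite nth_nil.
rewrite (_ : (fun _ => _) = fun t => if (j < n.+1)%N
    then nth 0 (elephant_steps X1 eta K n.+1 t) j
    else if j == n.+1 then elephant_X X1 eta K n.+2 t else 0); last first.
  apply/funext => t; rewrite elephant_stepsS// nth_rcons size_elephant_steps.
  by rewrite elephant_XS.
case: (j < n.+1)%N => //; case: (j == n.+1) => //.
under eq_fun do rewrite elephant_XS//.
apply: measurable_funM; first exact: meta.
have [//|n1] := eqVneq n.+1 1%N.
(* The entry at a random position is a finite sum of entries restricted to the events that [K]
   selects them. [K = 0] also points at position 0, since the predecessor of 0 is 0; positions past
   the end give the empty sum, matching the default 0 of [nth]. *)
rewrite (_ : (fun _ => _) = fun t => \sum_(k < n.+1)
    if ((K n.+2 t)%:R == k.+1%:R :> R) || ((K n.+2 t)%:R == 0 :> R) && (k == 0%N :> nat)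
    then nth 0 (elephant_steps X1 eta K n.+1 t) k else 0); last first.
  apply/funext => t; rewrite -big_mkcond.
  under eq_bigl => k do rewrite eqr_nat pnatr_eq0.
  have [le|lt] := leqP n.+1 (K n.+2 t).-1.
    rewrite nth_default; last by rewrite size_elephant_steps.
    rewrite big_pred0// => k; apply/negbTE.
    case: (K n.+2 t) le => [|l]//= le; rewrite orbF eqSS gt_eqF//.
    exact: leq_trans le.
  rewrite (big_pred1 (Ordinal lt))// => k; rewrite -[RHS]val_eqE/=.
  by case: (K n.+2 t) => [|l] /=; rewrite ?orbF// eq_sym.
apply: measurable_sum => k; apply: measurable_fun_ifT => //.
have mKn : measurable_fun setT (fun t => (K n.+2 t)%:R : R) by apply: mK; case: (n) n1.
by apply: measurable_or; [|apply: measurable_and => //];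
  apply: measurable_fun_eqr.
Qed.

Lemma measurable_elephant_S n : measurable_fun setT (elephant_S X1 eta K n).
Proof. by apply: measurable_sum => k; exact: measurable_nth_steps. Qed.

End measurability.

(** * Convergence of the law and of the moments *)

Theorem theorem8p1 (d : measure_display) (T : measurableType d) (R : realType)
  (P : probability T R) (p q r : R)
  (X1 : T -> R) (eta : nat -> T -> R) (K : nat -> T -> nat) :
  0 < p < 1 -> 0 < q < 1 -> 0 < r < 1 -> p + q + r = 1 ->
  measurable_fun setT X1 ->
  (forall n, (2 <= n)%N -> measurable_fun setT (eta n)) ->
  (forall n, (3 <= n)%N -> measurable_fun setT (fun t => (K n t)%:R : R)) ->
  P [set t | X1 t = 1] = p%:E ->
  P [set t | X1 t = -1] = q%:E ->
  P [set t | X1 t = 0] = r%:E ->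
  (forall n, (2 <= n)%N ->
     [/\ P [set t | eta n t = 1] = p%:E,
         P [set t | eta n t = -1] = q%:E &
         P [set t | eta n t = 0] = r%:E]) ->
  (forall n, (3 <= n)%N ->
     P [set t | K n t = 1%N] = (1 / 2)%:E /\
     P [set t | K n t = n.-1] = (1 / 2)%:E) ->
  discrete_mutually_independent P valid_idx (drive X1 eta K) ->
  let Sn n t := elephant_S X1 eta K n t / n%:R in
  [/\ (* convergence in distribution: E f(S_n/n) -> E f(S), f bounded continuous *)
      (forall f : R -> R, continuous f -> (exists M : R, forall x, `|f x| <= M) ->
         (fun n => (\int[P]_t (f (Sn n t))%:E)%E) @ \oo
           --> (limit_expect p q r f)%:E),
      (forall alpha : R, 0 < alpha ->
         (fun n => (\int[P]_t (`|Sn n t| `^ alpha)%:E)%E) @ \oo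
           --> (limit_expect p q r (fun x => `|x| `^ alpha))%:E) &
      (forall k : nat, (0 < k)%N ->
         (fun n => (\int[P]_t ((Sn n t) ^+ k)%:E)%E) @ \oo
           --> (limit_expect p q r (fun x => x ^+ k))%:E)].
Proof.
move=> /andP[p_gt0 _] /andP[q_gt0 _] /andP[r_gt0 _] pqr mX1 meta mK.
move=> X1p X1q X1r eta_law K_law indep Sn.
pose D := @driving_values R; pose w := driving_weight p q r.
have mF i : valid_idx i -> measurable_fun setT (drive X1 eta K i).
  by case: i => [[n|n]|] //= hn; [exact: meta|exact: mK].
have PF i x : valid_idx i -> x \in D i ->
    P [set t | drive X1 eta K i t = x] = (w i x)%:E.
  rewrite /w /driving_weight; case: i => [[n|n]|] /= hn; rewrite !inE.
  - have [ep eq er] := eta_law _ hn.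
    move=> /or3P[]/eqP->; rewrite ?eqxx// ?N1_neq1 ?zero_neqN1//.
    by rewrite [0 == 1]eq_sym oner_eq0.
  - have [K1 Kn] := K_law _ hn.
    have natE k : [set t | (K n t)%:R = k%:R :> R] = [set t | K n t = k].
      apply/seteqP; split => t /=; last by move=> ->.
      by move/eqP; rewrite eqr_nat => /eqP.
    by move=> /orP[]/eqP->; rewrite (natE 1%N, natE).
  - move=> /or3P[]/eqP->; rewrite ?eqxx// ?N1_neq1 ?zero_neqN1//.
    by rewrite [0 == 1]eq_sym oner_eq0.
have Du i : valid_idx i -> uniq (D i).
  case: i => [[n|n]|] /= hn; rewrite !inE ?andbT.
  - by rewrite ![1 == _]eq_sym N1_neq1 [-1 == 0]eq_sym zero_neqN1 [0 == 1]eq_sym oner_eq0.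
  (* The values 1 and [n - 1] are distinct because [n] is at least 3. *)
  - by rewrite eq_sym pnatr_eq1; case: n hn => [|[|[|]]].
  - by rewrite ![1 == _]eq_sym N1_neq1 [-1 == 0]eq_sym zero_neqN1 [0 == 1]eq_sym oner_eq0.
(* The value 1 is possible for every driving variable, which provides a base assignment. *)
have oneD : admissible D (fun=> 1) by case=> [[n|n]|]; rewrite !inE eqxx.
(* A bound on [[-1, 1]] alone is asked for, so that the unbounded power functions are covered too,
   with [B = 1]. *)
have main (f : R -> R) B : continuous f -> (forall x, `|x| <= 1 -> `|f x| <= B) ->
    (fun n => (\int[P]_t (f (Sn n t))%:E)%E) @ \oo --> (limit_expect p q r f)%:E.
  (* The shift matches the indexing of [walk_sum], which starts at time 2. *)
  move=> cf fB; rewrite -(cvg_shiftn 2).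
  have intE m : (\int[P]_t (f (Sn (m + 2)%N t))%:E)%E =
      (iexp D w (history m) (fun u => f (walk_sum u m / m.+2%:R)) (fun=> 1))%:E.
    rewrite addn2; apply: (integral_iexp _ mF PF Du indep) => //.
    - exact: driving_weight_sum1.
    - apply: measurableT_comp; first exact: continuous_measurable_fun.
      by apply: measurable_funM => //; exact: measurable_elephant_S.
    - by move=> t u uD tu; rewrite /Sn (elephant_S_walk uD tu).
    - exact: history_uniq.
    - exact: history_valid.
  rewrite (_ : (fun _ => _) = EFin \o (fun m => iexp D w (history m)
      (fun u => f (walk_sum u m / m.+2%:R)) (fun=> 1))); last first.
    by apply/funext => m; exact: intE.
  by apply: cvg_EFin; [exact: nearW|exact: (cvg_walk p_gt0 q_gt0 r_gt0 pqr cf fB oneD)].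
split.
- by move=> f cf [B fB]; apply: (main f B).
- move=> a a_gt0; apply: (main (fun x => `|x| `^ a) 1).
    exact: continuous_norm_powR.
  move=> x x_le1; rewrite ger0_norm ?powR_ge0//.
  have -> : 1 = 1 `^ a :> R by rewrite powR1.
  by apply: ge0_ler_powR; rewrite ?nnegrE// ltW.
- move=> k _; apply: (main (fun x => x ^+ k) 1); first exact: exprn_continuous.
  by move=> x x_le1; rewrite normrX exprn_ile1.
Qed.
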